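(* Let $p$ be an odd prime and let $m,n\in\mathbb N_{>0}$. Then $$v_p\left(\sum_{d\mid(m,n)}\mu(d)(-1)^{n/d}\sum_{\substack{0\le a\le n/d\\ p\mid a}}(-1)^a\binom{n/d}{a}\binom{a/p}{m/d}\right)\ge v_p(n)-1.$$ Consequently, if $v_p(n)\ge2$, then $$\sum_{d\mid(m,n)}\mu(d)(-1)^{n/d}\sum_{\substack{0\le a\le n/d\\ p\mid a}}(-1)^a\binom{n/d}{a}\binom{a/p}{m/d}\equiv0\pmod{p^{v_p(n)-1}}.$$
   Context: $v_p$ is the $p$-adic valuation (with $v_p(0)=\infty$), $\mu$ is the Möbius function, and $(m,n)$ denotes the greatest common divisor. *)

(* Defs.v *)
From mathcomp Require Import all_boot all_order all_algebra.
From mathcomp Require Import constructive_ereal.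
Set Implicit Arguments.
Unset Strict Implicit.
Unset Printing Implicit Defensive.
Import Order.TTheory GRing.Theory Num.Theory.
Local Open Scope ring_scope.

(* p-adic valuation on the integers, with values in [int] extended by
   infinities, so that v_p(0) = +oo (whereas [logn p 0 = 0]) and so that
   v_p(n) - 1 may be negative. *)
Definition vp (p : nat) (x : int) : \bar int :=
  if x == 0 then +oo%E else (logn p `|x|%N)%:Z%:E.

Lemma vp_nat (p n : nat) : (0 < n)%N -> vp p n%:Z = (logn p n)%:Z%:E.
Proof. by rewrite /vp; case: n. Qed.

Definition squarefree (n : nat) : bool :=
  (0 < n)%N && all (fun q => logn q n == 1%N) (primes n).

Definition moebius (n : nat) : int :=
  if squarefree n then (-1) ^+ size (primes n) else 0.

Definition moebius_sum (p m n : nat) : int :=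
  \sum_(d <- divisors (gcdn m n))
    moebius d * (-1) ^+ (n %/ d) *
    \sum_(0 <= a < (n %/ d).+1 | (p %| a)%N)
      (-1) ^+ a * ('C(n %/ d, a))%:Z * ('C(a %/ p, m %/ d))%:Z.

(* Main.v *)
Require Import Defs.
From mathcomp Require Import all_boot all_order all_algebra.
From mathcomp Require Import constructive_ereal.
From mathcomp Require Import ring zify.
Import Order.TTheory GRing.Theory Num.Theory.
Local Open Scope ring_scope.

(** Write [n = p N].  Modulo [p ^ v_p(n)] one has [C(p N, p b) = C(N, b)], so
    the inner sum is congruent to [\sum_b (-1)^b C(N, b) C(b, m)], which is
    [(-1)^N] if [m = N] and [0] otherwise.  A squarefree [d] costs at most one
    factor [p] in [n / d], hence modulo [p ^ (v_p(n) - 1)] the whole sum is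
    [\sum_(d %| m) mu(d)] if [n = p m] and [0] otherwise.  In the former case
    [p] divides [m], and the terms [d] and [p d] of the Moebius sum cancel. *)

(** Congruence modulo the ideal [k R], over any ring because it is applied both to integers and to
    integer polynomials. The explicit witness [c] lets a polynomial congruence pass to
    coefficients. *)
Definition eqmodr {R : pzRingType} (k : nat) (a b : R) :=
  exists c : R, a = b + k%:R * c.

(** Expand [(b + p ^ j c) ^ p]: the linear term gains a factor [p] from its binomial coefficient,
    and a term of degree [i + 2] in [c] carries [p ^ (j * (i + 2))], where [j * (i + 2) >= j + 1]
    since [j > 0]. *)
Lemma eqmodr_expp {R : comNzRingType} (p j : nat) (a b : R) :
  prime p -> (0 < j)%N -> eqmodr (p ^ j) a b ->
  eqmodr (p ^ j.+1) (a ^+ p) (b ^+ p).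
Proof.
case: p => [|[|q]] // _ j_gt0 [c ->]; set p := q.+2.
exists (b ^+ q.+1 * c + \sum_(i < q.+1)
  (p ^ (j * i.+2 - j.+1))%:R * ((b ^+ (p - i.+2) * c ^+ i.+2) *+ 'C(p, i.+2))).
rewrite exprDn !(big_ord_recl q.+2) (big_ord_recl q.+1) /= subn0 bin0 mulr1 mulr1n.
rewrite mulrDr; congr (_ + (_ + _)).
  rewrite /bump /= addn0 subn1 bin1 -mulr_natr !natrX expr1 exprSr.
  by ring.
rewrite mulr_sumr; apply: eq_bigr => i _.
rewrite /bump /= !add1n [RHS]mulrA -natrM -expnD.
have -> : (j.+1 + (j * i.+2 - j.+1) = j * i.+2)%N by rewrite subnKC; nia.
rewrite exprMn -natrX -expnM -!(mulr_natr (_ * _)).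
by ring.
Qed.

Lemma eqmodr_exp {R : comNzRingType} (k N : nat) (a b : R) :
  eqmodr k a b -> eqmodr k (a ^+ N) (b ^+ N).
Proof.
move=> [c Dc]; exists (c * \sum_(i < N) a ^+ (N.-1 - i) * b ^+ i).
by rewrite mulrA -[k%:R * c](addKr b) -Dc addrC addrC [- b + a]addrC -subrXX; ring.
Qed.

(** Induction on [k]: the base case is the Frobenius congruence modulo [p], and each further [p]-th
    power gains one factor [p] by [eqmodr_expp]. *)
Lemma eqmodr_exp1DX (p k : nat) : prime p ->
  eqmodr (p ^ k.+1) ((1 + 'X : {poly int}) ^+ (p ^ k.+1))
                    ((1 + 'X^p) ^+ (p ^ k)).
Proof.
move=> p_pr; elim: k => [|k IHk]; last first.
  rewrite [in X in eqmodr _ X](expnSr p k.+1) [in X in eqmodr _ _ X](expnSr p k).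
  by rewrite !exprM; apply: eqmodr_expp.
rewrite expn1 expn0 expr1.
case: p p_pr => [|q] // p_pr; set p := q.+1.
(* The middle binomial coefficients of the [p]-th power are divisible by [p]; the witness collects
   their quotients. *)
exists (\sum_(i < q) ('C(p, i.+1) %/ p)%:R * 'X^(i.+1)).
rewrite exprDn big_ord_recl big_ord_recr /= subn0 bin0.
rewrite !expr1n mul1r mulr1n /bump /= add1n binn mulr1n mul1r.
rewrite expr0 [in LHS](addrC (\sum_(_ < _) _)) addrA; congr (_ + _).
rewrite mulr_sumr; apply: eq_bigr => i _.
rewrite add1n expr1n mul1r mulrA -natrM mulnC divnK ?mulr_natl //.
by apply: prime_dvd_bin => //; have := ltn_ord i; lia.
Qed.

Lemma coef_exp1DX (n i : nat) :
  ((1 + 'X : {poly int}) ^+ n)`_i = ('C(n, i))%:Z.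
Proof.
rewrite exprDn coef_sum.
under eq_bigr => j _ do rewrite expr1n mul1r coefMn coefXn.
case: (ltnP i n.+1) => Hi; last first.
  rewrite bin_small // big1 // => j _.
  by have := ltn_ord j; case: eqP => [?|_]; rewrite ?mul0rn //; lia.
rewrite (bigD1 (Ordinal Hi)) //= eqxx big1 ?addr0 ?mulr1n ?natz //.
by move=> j /negPf; rewrite -val_eqE /= eq_sym => ->; rewrite mul0rn.
Qed.

(** With [N = p ^ k * N'] and [N'] prime to [p], raise [eqmodr_exp1DX] to the power [N'] and compare
    the coefficients of ['X^(p * b)]. *)
Lemma bin_mulp_eqmod (p N b : nat) : prime p -> (0 < N)%N ->
  eqmodr (p ^ logn p (p * N)) ('C(p * N, p * b))%:Z ('C(N, b))%:Z.
Proof.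
move=> p_pr N_gt0; have p_gt0 := prime_gt0 p_pr.
rewrite lognM // logn_prime // eqxx add1n.
have DN := partnC p N_gt0; rewrite p_part in DN.
have [c Dc] := eqmodr_exp _ (N`_p^')%N _ _ (eqmodr_exp1DX p (logn p N) p_pr).
exists c`_(p * b); move/(congr1 (fun q : {poly int} => q`_(p * b))): Dc.
rewrite -!exprM expnS -mulnA DN coef_exp1DX coefD => ->.
congr (_ + _); last by rewrite mulr_natl coefMn mulr_natl.
have -> : (1 + 'X^p : {poly int}) ^+ N = ((1 + 'X) ^+ N) \Po 'X^p.
  by rewrite rmorphXn /= rmorphD /= rmorph1 /= comp_polyX.
by rewrite coef_comp_poly_Xn // dvdn_mulr // mulKn // coef_exp1DX.
Qed.

(** Both sides are the coefficient of ['X^m] in [(1 - (1 + 'X)) ^+ N]. *)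
Lemma sum_sign_binM (N m : nat) :
  \sum_(0 <= b < N.+1) (-1) ^+ b * ('C(N, b))%:Z * ('C(b, m))%:Z
  = (-1) ^+ N * (m == N)%:Z.
Proof.
have signZ i (q : {poly int}) : (-1) ^+ i * q = (-1) ^+ i *: q.
  by rewrite -mul_polyC rmorph_sign.
have : (1 - (1 + 'X : {poly int})) ^+ N = (-1) ^+ N *: 'X^N.
  by rewrite opprD addNKr -signZ -exprNn.
move/(congr1 (fun q : {poly int} => q`_m)); rewrite coefZ coefXn natz => <-.
rewrite exprDn coef_sum big_mkord; apply: eq_bigr => i _.
rewrite expr1n mul1r [in RHS]exprNn coefMn signZ coefZ.
by rewrite coef_exp1DX -mulr_natr natz; ring.
Qed.

Lemma big_nat_dvd (V : nmodType) (p N : nat) (F : nat -> V) : (0 < p)%N ->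
  \sum_(0 <= a < (p * N).+1 | (p %| a)%N) F a = \sum_(0 <= b < N.+1) F (p * b)%N.
Proof.
move=> p_gt0; rewrite -(big_map (muln p) xpredT F) -[LHS]big_filter.
apply: perm_big; apply: uniq_perm.
- by rewrite filter_uniq ?iota_uniq.
- by rewrite map_inj_uniq ?iota_uniq // => x y /eqP; rewrite eqn_pmul2l // => /eqP.
move=> a; rewrite mem_filter mem_index_iota; apply/idP/mapP.
  case/andP=> /dvdnP[b ->]; rewrite mulnC ltnS leq_pmul2l // => le_bN.
  by exists b; rewrite ?mem_index_iota.
case=> b; rewrite mem_index_iota /= ltnS => le_bN ->.
by rewrite dvdn_mulr // ltnS leq_pmul2l.
Qed.

Lemma inner_sum_eqmod (p m N : nat) : prime p -> odd p -> (0 < N)%N ->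
  eqmodr (p ^ logn p (p * N))
    (\sum_(0 <= a < (p * N).+1 | (p %| a)%N)
      (-1) ^+ a * ('C(p * N, a))%:Z * ('C(a %/ p, m))%:Z)
    ((-1) ^+ N * (m == N)%:Z).
Proof.
move=> p_pr p_odd N_gt0; have p_gt0 := prime_gt0 p_pr.
rewrite big_nat_dvd // -sum_sign_binM.
apply: (big_ind2 (eqmodr _)) => [|_ y1 _ y2 [c1 ->] [c2 ->]|b _].
- by exists 0; rewrite mulr0 addr0.
- by exists (c1 + c2); ring.
have [c ->] := bin_mulp_eqmod p N b p_pr N_gt0.
exists ((-1) ^+ b * ('C(b, m))%:Z * c).
(* As [p] is odd, [(-1) ^+ (p * b)] equals [(-1) ^+ b]. *)
by rewrite mulKn // -signr_odd oddM p_odd signr_odd; ring.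
Qed.

Lemma squarefree_logn (d q : nat) : squarefree d -> (logn q d <= 1)%N.
Proof.
case/andP=> _ /allP sf; case: (boolP (q \in primes d)) => [/sf/eqP->//|].
by rewrite -logn_gt0 lt0n negbK => /eqP->.
Qed.

Lemma squarefreeP (d : nat) : (0 < d)%N ->
  reflect (forall q, (logn q d <= 1)%N) (squarefree d).
Proof.
move=> d_gt0; apply: (iffP idP) => [sf q|le1]; first exact: squarefree_logn.
rewrite /squarefree d_gt0; apply/allP => q; rewrite -logn_gt0 => lq.
by rewrite eqn_leq le1.
Qed.

Lemma moebius_primeM (p d : nat) : prime p -> (0 < d)%N -> ~~ (p %| d)%N ->
  moebius (p * d) = - moebius d.
Proof.
move=> p_pr d_gt0 p_ndvd; have p_gt0 := prime_gt0 p_pr.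
have pd_gt0 : (0 < p * d)%N by rewrite muln_gt0 p_gt0.
have lpd : logn p d = 0%N by apply: logn_coprime; rewrite prime_coprime.
rewrite /moebius; have -> : squarefree (p * d) = squarefree d.
  apply/(squarefreeP _ pd_gt0)/(squarefreeP _ d_gt0) => sf q; have := sf q;
    rewrite lognM // (logn_prime _ p_pr); case: (q =P p) => [->|_]; rewrite ?lpd //.
case: ifP => _; last by rewrite oppr0.
have -> : size (primes (p * d)) = size (p :: primes d).
  apply/perm_size/uniq_perm; rewrite /= ?primes_uniq ?andbT //.
    by rewrite mem_primes p_pr d_gt0.
  by move=> q; rewrite primesM // primes_prime // !inE.
by rewrite /= exprS mulN1r.
Qed.

(** Divisors split by their power of [p]: multiples of [p ^ 2] contribute zero, and those divisible
    by [p] exactly once are the [p * e] with [e] a divisor prime to [p], which cancels against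
    [p * e]. *)
Lemma sum_moebius_divisors (p m : nat) : prime p -> (0 < m)%N -> (p %| m)%N ->
  \sum_(d <- divisors m) moebius d = 0.
Proof.
move=> p_pr m_gt0 p_dvd; have p_gt0 := prime_gt0 p_pr.
rewrite (bigID (fun d => (p %| d)%N)) /=.
rewrite (bigID (fun d => (p ^ 2 %| d)%N)) /= big1_seq ?add0r; last first.
  move=> d /andP[/andP[_ p2d]]; rewrite -dvdn_divisors // => /dvdn_gt0 d_gt0.
  rewrite /moebius; case: ifP => // /(squarefree_logn _ p).
  by move: p2d; rewrite pfactor_dvdn ?d_gt0 //; lia.
rewrite -big_filter -[X in _ + X]big_filter.
set s := [seq d <- divisors m | ~~ (p %| d)%N].
have Ds : perm_eq [seq d <- divisors m | (p %| d)%N && ~~ (p ^ 2 %| d)%N]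
                  [seq (p * d)%N | d <- s].
  apply: uniq_perm; rewrite ?filter_uniq ?divisors_uniq //.
    rewrite map_inj_uniq ?filter_uniq ?divisors_uniq //.
    by move=> x y /eqP; rewrite eqn_pmul2l // => /eqP.
  move=> d; rewrite mem_filter -dvdn_divisors //; apply/idP/mapP.
    case/andP=> /andP[/dvdnP[e ->]]; rewrite mulnC dvdn_pmul2l // => p_e pe_m.
    exists e; rewrite // mem_filter p_e -dvdn_divisors //.
    by apply: dvdn_trans pe_m; rewrite dvdn_mull.
  case=> e; rewrite mem_filter -dvdn_divisors // => /andP[p_e e_m] ->.
  by rewrite dvdn_mulr // dvdn_pmul2l // p_e Gauss_dvd ?p_dvd // prime_coprime.
rewrite (perm_big _ Ds) big_map -big_split big1_seq //= => d.
rewrite mem_filter -dvdn_divisors // => /andP[p_d /dvdn_gt0 d_gt0].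
by rewrite moebius_primeM ?d_gt0 // addNr.
Qed.

Lemma dvdz_moebius_sum (p m n : nat) :
  prime p -> odd p -> (0 < m)%N -> (0 < n)%N ->
  ((p ^ (logn p n).-1)%N%:Z %| moebius_sum p m n)%Z.
Proof.
move=> p_pr p_odd m_gt0 n_gt0; have p_gt0 := prime_gt0 p_pr.
(* If [logn p n <= 1] the modulus is [p ^ 0 = 1]. Otherwise [p] still divides [n %/ d] for every
   squarefree [d]. *)
have [lt1|gt1] := leqP (logn p n) 1.
  have -> : ((logn p n).-1 = 0)%N by lia.
  exact: dvd1z.
have g_gt0 : (0 < gcdn m n)%N by rewrite gcdn_gt0 m_gt0.
(* This vanishing sum of main terms is subtracted termwise below. If [n = p * m], then [p ^ 2]
   dividing [n] forces [p] to divide [m]. *)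
have main0 : \sum_(d <- divisors (gcdn m n)) moebius d * (p * m == n)%N%:Z = 0.
  rewrite -mulr_suml; case: eqP => [Dn|_]; last by rewrite mulr0.
  have /gcdn_idPl-> : (m %| n)%N by rewrite -Dn dvdn_mull.
  rewrite (sum_moebius_divisors p) ?mul0r //.
  move: gt1; rewrite -Dn lognM // logn_prime // eqxx => gt1.
  by rewrite -[p]expn1 pfactor_dvdn //; lia.
rewrite -[moebius_sum p m n]subr0 -[X in _ - X]main0 /moebius_sum -sumrB big_seq.
apply: rpred_sum => d; rewrite -dvdn_divisors // dvdn_gcd => /andP[d_m d_n].
have d_gt0 := dvdn_gt0 n_gt0 d_n.
rewrite /moebius; case: ifP => [sf|_]; last by rewrite !mul0r subr0 dvdz0.
have ld := squarefree_logn _ p sf.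
have nd_gt0 : (0 < n %/ d)%N by rewrite divn_gt0 // dvdn_leq.
have lnd : ((logn p n).-1 <= logn p (n %/ d))%N by rewrite logn_div //; lia.
have p_nd : (p %| n %/ d)%N by rewrite -[p]expn1 pfactor_dvdn //; lia.
set N := (n %/ d %/ p)%N.
have DN : (n %/ d = p * N)%N by rewrite mulnC divnK.
have N_gt0 : (0 < N)%N by move: nd_gt0; rewrite DN; lia.
(* The condition independent of [d] becomes the one produced by [inner_sum_eqmod]. *)
have -> : (p * m == n)%N = (m %/ d == N)%N.
  rewrite -{1}(divnK d_m) -{1}(divnK d_n) DN mulnA eqn_pmul2r //.
  by rewrite eqn_pmul2l.
rewrite DN in lnd *; have [c ->] := inner_sum_eqmod p (m %/ d) N p_pr p_odd N_gt0.
rewrite -[(-1) ^+ (p * N)]signr_odd oddM p_odd signr_odd.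
set mu := (-1) ^+ size _; set e := (_ == N)%:Z; set s := (-1) ^+ N.
(* The outer sign [(-1) ^+ (n %/ d)] and the sign of the inner sum are both [s], so they cancel and
   the main term is [mu * e]. *)
have ss : s * s = 1 by rewrite -expr2 sqrr_sign.
rewrite mulrDr [X in X + _ - _](_ : _ = s * s * (mu * e)); last by ring.
rewrite ss mul1r addrAC subrr add0r mulrA mulrAC natz.
by rewrite dvdz_mull // dvdzE !absz_nat dvdn_exp2l.
Qed.

Theorem corollary1p6 (p m n : nat) (p_prime : prime p) (p_odd : odd p)
    (m_gt0 : (0 < m)%N) (n_gt0 : (0 < n)%N) :
  (vp p n%:Z - 1%:E <= vp p (moebius_sum p m n))%E /\
  ((2%:E <= vp p n%:Z)%E ->
   (moebius_sum p m n = 0 %[mod (p ^ (logn p n).-1)%N%:Z])%Z).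
Proof.
have dvd_sum := dvdz_moebius_sum p m n p_prime p_odd m_gt0 n_gt0.
split=> [|_]; last by apply/eqP; rewrite eqz_mod_dvd subr0.
rewrite vp_nat // /vp; case: eqP => [_|/eqP nz]; first by rewrite leey.
move: dvd_sum; rewrite dvdzE absz_nat pfactor_dvdn ?absz_gt0 // => le_log.
(* The truncated predecessor is at least the integer [logn p n - 1], which is [-1] when [p] does not
   divide [n]. *)
by rewrite -EFinB lee_fin; lia.
Qed.
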